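(* The optimal density of a $(2,2)$ broadcast for $H_{\infty,\infty}$ satisfies \[\delta_{2,2}(H_{\infty,\infty})\leq \frac12.\]
   Context: The infinite truncated square tiling graph $H_{\infty,\infty}$ has vertex set $\{(a,(x,y)) : a\in\mathbb{Z}_4,\ (x,y)\in\mathbb{Z}^2\}$. Its edges are: $(a,(x,y))\sim(a+1,(x,y))$ with $a+1$ taken modulo 4 (so each $(x,y)$ carries a 4-cycle whose vertices $0,1,2,3$ are its top, right, bottom, left vertices); $(1,(x,y))\sim(3,(x+1,y))$; and $(0,(x,y))\sim(2,(x,y+1))$. For $(x,y)\in\mathbb{Z}^2$ the octagon $O_{x,y}$ is the 8-cycle through $(0,(x,y)),(1,(x,y)),(3,(x+1,y)),(0,(x+1,y)),(2,(x+1,y+1)),(3,(x+1,y+1)),(1,(x,y+1)),(2,(x,y+1))$, in this cyclic order. For a graph $G$ and integers $1\le r\le t$, a set $T\subseteq V(G)$ is a $(t,r)$ broadcast of $G$ if every $u\in V(G)$ satisfies $\sum_{v\in T,\ d(u,v)<t}(t-d(u,v))\ge r$, where $d$ is the graph distance in $G$. The broadcast density of a $(t,r)$ broadcast $T$ for $H_{\infty,\infty}$ is $\lim_{n\to\infty}|T\cap V(B_n)|/|V(B_n)|$, where $B_n$ is the finite portion of the graph given by the union of the octagons $O_{x,y}$ with $-n\le x,y\le n-1$. The optimal density $\delta_{t,r}(H_{\infty,\infty})$ is the minimum (infimum) of the broadcast densities over all $(t,r)$ broadcasts $T$ of $H_{\infty,\infty}$ for which the limit exists. *)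

(* Defs.v *)
From HB Require Import structures.
From mathcomp Require Import all_boot all_order all_algebra finmap.
From mathcomp Require Import all_classical all_reals all_analysis.
Set Implicit Arguments.
Unset Strict Implicit.
Unset Printing Implicit Defensive.
Import Order.TTheory GRing.Theory Num.Theory.
Import numFieldNormedType.Exports.
Local Open Scope classical_set_scope.
Local Open Scope ring_scope.

(* In the general definitions a graph is given by its adjacency relation [e]. *)

(* The distance is [+oo] between vertices in different components. *)
Definition gdist (R : realType) (V : eqType) (e : rel V) (u v : V) : \bar R :=
  ereal_inf [set (size p)%:R%:E | p in [set p : seq V | path e u p /\ last u p = v]].

(* [\esum] is an unconditional sum of nonnegative extended reals, so no
   local finiteness of the graph is needed. *)
Definition reception (R : realType) (V : choiceType) (e : rel V) (t : nat)
    (T : set V) (u : V) : \bar R :=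
  \esum_(v in T `&` [set v | (gdist R e u v < t%:R%:E)%E])
    (t%:R%:E - gdist R e u v)%E.

Definition broadcast (R : realType) (V : choiceType) (e : rel V) (t r : nat)
    (T : set V) : Prop :=
  forall u : V, (r%:R%:E <= reception R e t T u)%E.

Definition Hvertex : choiceType := ('Z_4 * (int * int))%type.

Definition Harc (u v : Hvertex) : bool :=
  let: (a, (x, y)) := u in
  [|| v == (a + 1, (x, y)),
      (a == 1) && (v == (3, (x + 1, y)))
    | (a == 0) && (v == (2, (x, y + 1)))].

Definition Hadj : rel Hvertex := fun u v => Harc u v || Harc v u.

Lemma Hadj_sym : symmetric Hadj.
Proof. by move=> u v; rewrite /Hadj orbC. Qed.

Lemma Hadj_irr : irreflexive Hadj.
Proof.
move=> [a [x y]]; rewrite /Hadj /Harc orbb !xpair_eqE.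
by case: a => [[|[|[|[|]]]]].
Qed.

Definition octagon (x y : int) : seq Hvertex :=
  [:: (0, (x, y)); (1, (x, y)); (3, (x + 1, y)); (0, (x + 1, y));
      (2, (x + 1, y + 1)); (3, (x + 1, y + 1)); (1, (x, y + 1));
      (2, (x, y + 1))].

Lemma octagon_cycle (x y : int) : ucycle Hadj (octagon x y).
Proof.
have neqS (z : int) : (z == z + 1) = false.
  by rewrite -subr_eq0 opprD addNKr.
apply/andP; split.
  by rewrite /= /Hadj /Harc !xpair_eqE !eqxx !neqS.
by rewrite /= !inE !xpair_eqE !(neqS, eq_sym (_ + 1) _) ?andbF.
Qed.

(* The vertices of the octagons O_{x,y} with -n <= x, y <= n - 1. *)
Definition HB (n : nat) : {fset Hvertex} :=
  \big[fsetU/fset0]_(i < n.*2) \big[fsetU/fset0]_(j < n.*2)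
    [fset v in octagon (i%:Z - n%:Z) (j%:Z - n%:Z)]%fset.

Definition has_density (R : realType) (T : set Hvertex) (d : R) : Prop :=
  (fun n : nat => #|` [fset v in HB n | v \in T]%fset|%:R / #|` HB n|%:R : R)
    @ \oo --> d.

(* Taken in the extended reals, so that the infimum over an empty family of
   broadcasts would be [+oo]. *)
Definition optimal_density (R : realType) (t r : nat) : \bar R :=
  ereal_inf [set d%:E | d in [set d : R | exists T : set Hvertex,
    broadcast R Hadj t r T /\ has_density T d]].

(* Main.v *)
Require Import Defs.
From HB Require Import structures.
From mathcomp Require Import all_boot all_order all_algebra finmap.
From mathcomp Require Import all_classical all_reals all_analysis.
Import Order.TTheory GRing.Theory Num.Theory.
Import numFieldNormedType.Exports.
Local Open Scope ring_scope.

(** A set [T] is a (2,2) broadcast as soon as every vertex outside [T] has two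
    neighbours in [T]: a member of [T] supplies itself with 2, and each
    neighbour in [T] supplies 1.  The set of top and bottom vertices has this
    property, since every 4-cycle alternates between that set and its
    complement ([two_dominating_broadcast],
    [broadcast_top_bottom]).

    Its density is exactly 1/2, without any boundary term: reflecting the
    tiling in the diagonal exchanges top with right and bottom with left, hence
    the set with its complement, while it permutes the octagons that make up
    each finite portion ([has_density_half], [reflect_HB]). *)

Lemma gdist_path_le (R : realType) (V : eqType) (e : rel V) (u v : V)
    (p : seq V) :
  path e u p -> last u p = v -> (gdist R e u v <= (size p)%:R%:E)%E.
Proof. by move=> ep lp; apply: ereal_inf_lbound; exists p. Qed.

(** A finite part of [T] bounds the reception from below, even if each distance
    is only known up to an upper bound [c]; this spares computing distances. *)
Lemma reception_ge (R : realType) (V : choiceType) (e : rel V) (t : nat)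
    (T : set V) (u : V) (c : nat) (F : {fset V}) :
  (c < t)%N ->
  (forall v, v \in F -> T v /\ (gdist R e u v <= c%:R%:E)%E) ->
  ((#|` F| * (t - c))%:R%:E <= reception R e t T u)%E.
Proof.
move=> ct FT; apply: esum_ge; exists [set` F]%classic.
  split; first exact: finite_fset.
  move=> v /= /FT[Tv dv]; split=> //=.
  by apply: le_lt_trans dv _; rewrite lte_fin ltr_nat.
rewrite fsbig_finite//= set_fsetK.
have -> : (#|` F| * (t - c))%:R%:E = (\sum_(v <- F) ((t - c)%:R : R)%:E)%E.
  by rewrite sumEFin big_const_seq count_predT iter_addr_0 -mulrnA mulnC.
rewrite big_seq [leRHS]big_seq; apply: lee_sum => v /FT[_ dv].
by rewrite natrB ?(ltnW ct)// EFinB leeB.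
Qed.

Lemma two_dominating_broadcast (R : realType) (V : choiceType) (e : rel V)
    (T : set V) :
  (forall u, ~ T u ->
    exists v w, [/\ v != w, T v, T w, e u v & e u w]) ->
  broadcast R e 2 2 T.
Proof.
move=> T2 u; have [Tu|/T2[v [w [vw Tv Tw uv uw]]]] := pselect (T u).
  have := @reception_ge R V e 2 T u 0 [fset u]%fset; rewrite cardfs1.
  apply=> // v; rewrite inE => /eqP ->; split=> //.
  exact: (@gdist_path_le _ _ _ _ _ [::]).
have := @reception_ge R V e 2 T u 1 [fset v; w]%fset; rewrite cardfs2 vw.
by apply=> // z; rewrite !inE => /orP[]/eqP ->; split=> //;
  [apply: (@gdist_path_le _ _ _ _ _ [:: v])|
   apply: (@gdist_path_le _ _ _ _ _ [:: w])]; rewrite //= ?uv ?uw.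
Qed.

Definition top_bottom : set Hvertex := [set v : Hvertex | ~~ odd v.1]%classic.

Lemma broadcast_top_bottom (R : realType) : broadcast R Hadj 2 2 top_bottom.
Proof.
apply: two_dominating_broadcast => -[a p] /= /negP/negPn odda.
exists (a + 1, p), (a - 1, p); move: odda; rewrite /top_bottom /Hadj /Harc.
case: p => x y; rewrite subrK !eqxx /= orbT.
by case: a => -[|[|[|[|]]]].
Qed.

(** The reflection in the diagonal reverses the orientation of each 4-cycle, so
    on labels it is [a |-> 1 - a]: top and right are exchanged, and so are
    bottom and left. *)
Definition reflect_diag (v : Hvertex) : Hvertex :=
  (1 - v.1, (v.2.2, v.2.1)).

Lemma reflect_diagK : involutive reflect_diag.
Proof. by move=> [a [x y]]; rewrite /reflect_diag /= subKr. Qed.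

Lemma reflect_octagon (x y : int) (v : Hvertex) :
  v \in octagon x y -> reflect_diag v \in octagon y x.
Proof.
rewrite !inE; do 7?[case/orP]; move/eqP->.
all: by rewrite /reflect_diag /= !xpair_eqE !eqxx ?orbT.
Qed.

Lemma in_HB (n : nat) (v : Hvertex) :
  reflect (exists i j : 'I_n.*2, v \in octagon (i%:Z - n%:Z) (j%:Z - n%:Z))
    (v \in HB n).
Proof.
apply: (iffP (bigfcupP _ _ _ _)).
  by move=> [i _ /bigfcupP[j _ vij]]; exists i, j; rewrite in_fset in vij.
move=> [i [j vij]]; exists i; rewrite ?mem_index_enum//.
by apply/bigfcupP; exists j; rewrite ?mem_index_enum ?inE.
Qed.

Lemma reflect_HB (n : nat) (v : Hvertex) :
  v \in HB n -> reflect_diag v \in HB n.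
Proof.
by move=> /in_HB[i [j vij]]; apply/in_HB; exists j, i; apply: reflect_octagon.
Qed.

Lemma HB_gt0 (n : nat) : (0 < n)%N -> (0 < #|` HB n|)%N.
Proof.
case: n => // n _; rewrite cardfs_gt0; apply/fset0Pn.
exists (0, (- n.+1%:Z, - n.+1%:Z)); apply/in_HB.
by exists ord0, ord0; rewrite !sub0r inE eqxx.
Qed.

(** An involution that preserves each finite portion and exchanges [T] with its
    complement is a bijection between the two halves of each portion. *)
Lemma has_density_half (R : realType) (T : set Hvertex)
    (s : Hvertex -> Hvertex) :
  involutive s -> (forall n v, v \in HB n -> s v \in HB n) ->
  (forall v, T (s v) <-> ~ T v) ->
  has_density T (1 / 2 : R).
Proof.
move=> sK sHB sT; apply: cvg_near_cst; near=> n.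
have n0 : (0 < n)%N by near: n; exists 1%N.
set D := [fset v in HB n | v \in T]%fset.
have sTb v : (s v \in T) = (v \notin T).
  by apply/idP/idP => [/set_mem/sT nT|/negP nT];
     [apply/negP => /set_mem | apply/mem_set/sT => /mem_set].
have sD : [fset s v | v in D]%fset = (HB n `\` D)%fset.
  apply/fsetP => v; apply/imfsetP/idP => /=.
    by move=> [w]; rewrite !inE/= => /andP[wn wT] ->; rewrite sTb wT sHB ?andbT.
  rewrite !inE/= => /andP[]; rewrite negb_and => /orP[/negP//|nT] vn.
  by exists (s v); rewrite ?sK// !inE/= sTb nT sHB.
have cHB : (#|` HB n| = #|` D| * 2)%N.
  have DHB : (HB n `&` D)%fset = D.
    by apply/fsetIidPr/fsubsetP => v; rewrite !inE => /andP[].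
  rewrite -(cardfsID D (HB n)) DHB -sD (card_imfset _ _ (inv_inj sK)).
  by rewrite muln2 addnn.
have := HB_gt0 _ n0; rewrite cHB muln_gt0 andbT => D0.
by rewrite natrM invfM mulrA divff ?pnatr_eq0 -?lt0n.
Unshelve. all: by end_near. Qed.

Lemma has_density_top_bottom (R : realType) :
  has_density top_bottom (1 / 2 : R).
Proof.
apply: (has_density_half _ _ _ reflect_diagK reflect_HB) => -[a p].
by rewrite /top_bottom /=; case: a => -[|[|[|[|]]]].
Qed.

Theorem theorem4p3 (R : realType) :
  (optimal_density R 2 2 <= (1 / 2)%:E)%E.
Proof.
apply: ereal_inf_lbound; exists (1 / 2) => //; exists top_bottom.
by split; [exact: broadcast_top_bottom | exact: has_density_top_bottom].
Qed.
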